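(* Let $m\in\mathbb{Z}_+$ and consider the polytope $$P=\left\{\begin{bmatrix} x \\ y \end{bmatrix}\in[0,1]^{2m}\;\middle|\;2(x_1+y_1)+2^2(x_2+y_2)+\dots+2^m(x_m+y_m)\le 2^{m+1}-1\right\},$$ where $x,y\in\mathbb{R}^m$, in dimension $n=2m$. Let $W,W'\in\mathbb{Z}^{k\times m}$ be integral matrices and let $$Q=\operatorname{conv}\left(P\cap\left\{\begin{bmatrix} x \\ y \end{bmatrix}\;\middle|\;[W\;\;W']\begin{bmatrix} x \\ y \end{bmatrix}\in\mathbb{Z}^k\right\}\right).$$ If $k<m$, then $Q$ is not an integral polyhedron.
   Context: A polyhedron $Q\subseteq\mathbb{R}^{n}$ is called integral if $Q=\operatorname{conv}(Q\cap\mathbb{Z}^{n})$. *)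

(* Defs.v *)
(* MathComp world, with MathComp-Analysis for the real numbers and for sets. *)
From mathcomp Require Import all_boot all_order all_algebra archimedean.
From mathcomp Require Import boolp classical_sets reals convex.

Set Implicit Arguments.
Unset Strict Implicit.
Unset Printing Implicit Defensive.

Import Order.TTheory GRing.Theory Num.Theory.
Local Open Scope classical_set_scope.
Local Open Scope ring_scope.

Definition conv_hull (R : realType) (n : nat) (A : set 'cV[R]_n) :
    set 'cV[R]_n :=
  smallest (@convex_set R 'cV[R]_n) A.

Definition integer_points (R : realType) (n : nat) : set 'cV[R]_n :=
  [set v : 'cV[R]_n | v \is a mxOver Num.int].

(* A polyhedron [Q] is integral when this equality holds; that [Q] be a
   polyhedron is not part of the predicate, so its negation really says that
   the equality fails. *)
Definition is_integral (R : realType) (n : nat) (Q : set 'cV[R]_n) : Prop :=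
  Q = conv_hull (Q `&` @integer_points R n).

(* A point of R^(2m) is the column [x; y] = [col_mx x y]. The coordinates
   x_1, ..., x_m are [x 0 0, ..., x (m-1) 0], whence the exponent [i.+1]. *)
Definition knapsack_polytope (R : realType) (m : nat) : set 'cV[R]_(m + m) :=
  [set v : 'cV[R]_(m + m) |
           (forall j, 0 <= v j 0 <= 1) /\
           \sum_(i < m) 2 ^+ i.+1 * (usubmx v i 0 + dsubmx v i 0)
             <= 2 ^+ m.+1 - 1].

Definition integrality_set (R : realType) (k n : nat) (A : 'M[int]_(k, n)) :
    set 'cV[R]_n :=
  [set v : 'cV[R]_n | map_mx intr A *m v \is a mxOver Num.int].

(* Main.v *)
(* Numbering coordinates from 0, an integer point of P has tail weight
   sum_(i >= j) 2^(i+1) (x_i + y_i) at most 2^(m+1) - 1 and divisible by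
   2^(j+1), hence at most 2^(m+1) - 2^(j+1). If Q were integral, all of Q would
   satisfy this for every j. Since k < m, the matrix W has a nonzero kernel
   vector modulo 2, i.e. some nonzero z in {0,1}^m with W z even, so that
   x = z/2 satisfies the integrality constraint. With j the least index in the
   support of z, this x can be completed by a 0/1 vector y to a point of P of
   tail weight exactly 2^(m+1) - 2^j, a contradiction. *)
From HB Require Import structures.
Require Import Defs.
From mathcomp Require Import all_boot all_order all_algebra archimedean.
From mathcomp Require Import boolp classical_sets reals convex.
From mathcomp Require Import interval_inference ring lra.

Set Implicit Arguments.
Unset Strict Implicit.
Unset Printing Implicit Defensive.

Import Order.TTheory GRing.Theory Num.Theory.
Local Open Scope classical_set_scope.
Local Open Scope ring_scope.

(** Over ['F_2] the transpose of [W] has more rows than columns, so its left kernel contains a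
    nonzero vector, and [z] is the support of that vector. It is extended by [false] to all of [nat]
    so that [z i.+1] still makes sense at the last coordinate. *)
Lemma exists_bool_mod2_kernel (m k : nat) (W : 'M[int]_(k, m)) :
  (k < m)%N ->
  exists z : nat -> bool,
    [/\ forall i, (m <= i)%N -> z i = false,
        exists i, z i &
        forall r, (2 %| \sum_(i < m) W r i * (z i)%:R)%Z].
Proof.
move=> ltkm.
pose A : 'M['F_2]_(m, k) := (map_mx intr W)^T.
have kerN0 : kermx A != 0.
  rewrite -mxrank_eq0 mxrank_ker subn_eq0 -ltnNge.
  exact: leq_ltn_trans (rank_leq_col A) ltkm.
have /rowV0Pn[u /sub_kermxP uA0 uN0] := kerN0.
pose z n := oapp (fun i : 'I_m => u 0 i != 0) false (insub n).
have zE (i : 'I_m) : z i = (u 0 i != 0) by rewrite /z valK.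
exists z; split.
- by move=> i lemi; rewrite /z insubF // ltnNge lemi.
- have [i uiN0] : exists i, u 0 i != 0 by apply/rV0Pn.
  by exists i; rewrite zE.
- move=> r; rewrite (dvdz_pcharf (pchar_Fp (isT : prime 2))) rmorph_sum /=.
  have /rowP/(_ r) := uA0; rewrite !mxE => u0.
  rewrite -[X in _ == X]u0; apply/eqP/eq_bigr => i _.
  rewrite !mxE rmorphM /= mulrC rmorph_nat zE; congr (_ * _).
  (* An element of ['F_2] is 0 or 1, hence equal to the indicator of its being nonzero. *)
  by case: (u 0 i) => -[|[|//]] ? //; apply/val_inj.
Qed.

Definition tail_weight (R : realType) (m j : nat) (v : 'cV[R]_(m + m)) : R :=
  \sum_(i < m | (j <= i)%N) 2 ^+ i.+1 * (usubmx v i 0 + dsubmx v i 0).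

Lemma tail_weight_is_scalar (R : realType) (m j : nat) :
  scalar (@tail_weight R m j).
Proof.
move=> a u v; rewrite /tail_weight mulr_sumr -big_split /=.
by apply: eq_bigr => i _; rewrite !mxE; ring.
Qed.

HB.instance Definition _ (R : realType) (m j : nat) :=
  GRing.isLinear.Build R 'cV[R]_(m + m) R *%R (@tail_weight R m j)
    (@tail_weight_is_scalar R m j).

Lemma convex_halfspace (R : realType) (V : lmodType R) (f : {scalar V})
    (c : R) :
  convex_set [set v : V | f v <= c].
Proof.
apply/convex_setW => x y /[!inE] /= fx fy t t0 t1; rewrite inE.
change (f (t%:num *: x + (1 - t%:num) *: y) <= c).
rewrite linearD !linearZ /=; nra.
Qed.

Lemma knapsack_polytopeE (R : realType) (m : nat) (v : 'cV[R]_(m + m)) :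
  knapsack_polytope v <->
  (forall j, 0 <= v j 0 <= 1) /\ tail_weight 0 v <= 2 ^+ m.+1 - 1.
Proof. by []. Qed.

Lemma convex_knapsack (R : realType) (m : nat) :
  convex_set (@knapsack_polytope R m).
Proof.
move=> x y t /[!inE] -[x01 wx] [y01 wy].
apply/knapsack_polytopeE; split.
  move=> j; rewrite !mxE.
  have /andP[xj0 xj1] := x01 j; have /andP[yj0 yj1] := y01 j.
  have t0 : 0 <= t%:num by [].
  have t1 : t%:num <= 1 by [].
  change (0 <= t%:num * x j 0 + (1 - t%:num) * y j 0 <= 1).
  by apply/andP; split; nra.
have := @convex_halfspace R _ (@tail_weight R m 0) (2 ^+ m.+1 - 1) x y t.
by rewrite !inE; apply.
Qed.

Lemma tail_weight_integer_point (R : realType) (m j : nat)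
    (v : 'cV[R]_(m + m)) :
  (j <= m)%N -> knapsack_polytope v -> v \is a mxOver Num.int ->
  tail_weight j v <= 2 ^+ m.+1 - 2 ^+ j.+1.
Proof.
move=> lejm [v01 wv] /mxOverP vint.
(* The tail weight divided by [2 ^+ j.+1]; the exponents [i - j] are true differences because
   [j <= i]. *)
pose N : R := \sum_(i < m | (j <= i)%N)
  2 ^+ (i - j) * (usubmx v i 0 + dsubmx v i 0).
have wE : tail_weight j v = 2 ^+ j.+1 * N.
  rewrite mulr_sumr; apply: eq_bigr => i leji.
  by rewrite mulrA -exprD addSn subnKC.
have Nint : N \is a Num.int.
  apply: rpred_sum => i _; rewrite !mxE.
  by rewrite rpredM ?rpredD ?rpredX ?rpred_nat.
have le_full : tail_weight j v <= 2 ^+ m.+1 - 1.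
  apply: le_trans wv; rewrite /tail_weight big_mkcond /=.
  apply: ler_sum => i _; case: ifP => // _.
  rewrite !mxE mulr_ge0 ?exprn_ge0 ?addr_ge0 //.
    by have /andP[] := v01 (lshift m i).
  by have /andP[] := v01 (rshift m i).
have pow_split : 2 ^+ m.+1 = 2 ^+ j.+1 * 2 ^+ (m - j) :> R.
  by rewrite -exprD addSn subnKC.
have ltN : N < 2 ^+ (m - j).
  rewrite -(ltr_pM2l (exprn_gt0 j.+1 (ltr0n R 2))) -wE -pow_split.
  by apply: le_lt_trans le_full _; rewrite gtrBl.
(* Both sides of [ltN] are integers, so the strict inequality gains a full unit. *)
have leN : N + 1 <= 2 ^+ (m - j).
  case/intrP: Nint ltN => n ->.
  have -> : 2 ^+ (m - j) = (2 ^+ (m - j) : int)%:~R :> R by rewrite rmorphXn.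
  by rewrite ltr_int -lezD1 -(ler_int R) intrD.
rewrite wE pow_split lerBrDr -[X in _ + X]mulr1 -mulrDr.
by rewrite ler_pM2l // exprn_gt0.
Qed.

Lemma telescope_sum_ord_ge (V : zmodType) (m j : nat) (f : nat -> V) :
  (j <= m)%N -> \sum_(i < m | (j <= i)%N) (f i.+1 - f i) = f m - f j.
Proof.
move=> lejm; rewrite -(telescope_sumr f lejm).
by rewrite [RHS](big_nat_widenl _ 0) // big_mkord.
Qed.

(* The bits of [y] are complements of the bits of [z] shifted by one, so that
   the sum of the [2 ^+ i.+1 * (x_i + y_i)] over [i >= j] telescopes. *)
Definition half_point (R : realType) (m j : nat) (z : nat -> bool) :
    'cV[R]_(m + m) :=
  col_mx (\col_(i < m) ((z i)%:R / 2))
         (\col_(i < m) ((j <= i)%N && ~~ z i.+1)%:R).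

(** Coordinates below [j] vanish, so the value does not depend on [l]: [l = 0] serves the knapsack
    constraint, [l = j] the final contradiction. *)
Lemma tail_weight_half_point (R : realType) (m j l : nat) (z : nat -> bool) :
  (l <= j <= m)%N -> (forall i, (i < j)%N -> z i = false) -> z j ->
  z m = false ->
  tail_weight l (half_point R m j z) = 2 ^+ m.+1 - 2 ^+ j.
Proof.
move=> /andP[lelj lejm] zlt zj zm.
(* For [i >= j] the summand is [2 ^+ i * z_i + 2 ^+ i.+1 * (1 - z_(i+1))], which is
   [f i.+1 - f i]. *)
pose f i : R := 2 ^+ i.+1 - 2 ^+ i * (z i)%:R.
have -> : 2 ^+ m.+1 - 2 ^+ j = f m - f j.
  by rewrite /f zj zm !exprS /=; ring.
rewrite -(telescope_sum_ord_ge f lejm) /tail_weight.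
rewrite big_mkcond [RHS]big_mkcond; apply: eq_bigr => i _ /=.
rewrite /half_point col_mxKu col_mxKd !mxE.
have [leji|ltij] := leqP j i.
  rewrite (leq_trans lelj leji) /f !exprS.
  by case: (z i.+1) => /=; field.
by rewrite zlt // mul0r addr0 mulr0 if_same.
Qed.

Lemma half_point_knapsack (R : realType) (m j : nat) (z : nat -> bool) :
  (j <= m)%N -> (forall i, (i < j)%N -> z i = false) -> z j ->
  z m = false ->
  knapsack_polytope (half_point R m j z).
Proof.
move=> lejm zlt zj zm; apply/knapsack_polytopeE; split.
  move=> i; rewrite mxE; case: split => a; rewrite mxE.
    by case: (z a) => /=; lra.
  by rewrite ler0n lern1 leq_b1.
rewrite tail_weight_half_point // lerD2l lerN2.
by rewrite exprn_ege1 // ler1n.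
Qed.

(** The [y] part is integral, so [W'] contributes an integer whatever its entries; the [x] part
    contributes half of an even integer. *)
Lemma half_point_integrality (R : realType) (m k j : nat)
    (W W' : 'M[int]_(k, m)) (z : nat -> bool) :
  (forall r, (2 %| \sum_(i < m) W r i * (z i)%:R)%Z) ->
  integrality_set (row_mx W W') (half_point R m j z).
Proof.
move=> Wz; apply/mxOverP => r c.
rewrite map_row_mx mul_row_col mxE rpredD // mxE; last first.
  by apply: rpred_sum => i _; rewrite !mxE rpredM ?rpred_nat ?intr_int.
have /dvdzP[q Wq] := Wz r.
apply/intrP; exists q.
apply: (@mulIf _ (2%:~R : R)); first by rewrite intr_eq0.
rewrite -intrM -Wq rmorph_sum /= mulr_suml; apply: eq_bigr => i _.
by rewrite !mxE rmorphM rmorph_nat /=; field.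
Qed.

Theorem lemma21 (R : realType) (m k : nat) (W W' : 'M[int]_(k, m))
    (hkm : (k < m)%N) :
  ~ is_integral
      (conv_hull (@knapsack_polytope R m `&`
                  @integrality_set R k (m + m) (row_mx W W'))).
Proof.
have [z [z_ge z_ex Wz]] := exists_bool_mod2_kernel W hkm.
case: (ex_minnP z_ex) => j zj j_min.
have ltjm : (j < m)%N by rewrite ltnNge; apply: contraL zj => /z_ge ->.
have z_lt i : (i < j)%N -> z i = false.
  by move=> ltij; apply: contraTF ltij => /j_min; rewrite -leqNgt.
have zm : z m = false by apply: z_ge.
set Q := conv_hull _ => Q_int.
have Qp : Q (half_point R m j z).
  apply: sub_gen_smallest; split.
    exact: half_point_knapsack (ltnW ltjm) z_lt zj zm.
  exact: half_point_integrality.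
(* Convexity of the polytope keeps the hull inside it, so the bound for integer points applies to
   those of [Q]. *)
have QP : Q `<=` @knapsack_polytope R m.
  by apply: smallest_sub; [exact: convex_knapsack | move=> v []].
have : tail_weight j (half_point R m j z) <= 2 ^+ m.+1 - 2 ^+ j.+1.
  rewrite Q_int in Qp; move: Qp.
  (* A half-space containing the integer points of [Q] contains their hull, which is [Q] by
     assumption. *)
  pose H : set 'cV[R]_(m + m) :=
    [set v | tail_weight j v <= 2 ^+ m.+1 - 2 ^+ j.+1].
  apply: (smallest_sub (X := H)).
    exact: convex_halfspace.
  move=> v [/QP Pv v_int].
  exact: tail_weight_integer_point (ltnW ltjm) Pv v_int.
rewrite tail_weight_half_point ?leqnn ?(ltnW ltjm) // lerD2l lerN2.
(* What remains is the absurd [2 ^+ j.+1 <= 2 ^+ j]. *)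
by rewrite leNgt exprS ltr_pMl ?exprn_gt0 // ltr1n.
Qed.
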